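(* In the setting of the context, let $\lambda_0=\inf\{D(f):\mu(f^2)=1,\ f\in\mathscr K\}$. (1) Suppose $\sum_{k=1}^N\frac1{\mu_ka_k}<\infty$. Define dual rates $\hat b_i=a_{i+1}$, $\hat a_i=b_i$ for $0\le i<N+1$ (with $b_0:=0$, and $a_{N+1}:=0$ if $N<\infty$) on $\widehat E=\{i:0\le i<N+1\}$, and let $\hat\lambda_1$ be the first non-trivial eigenvalue of the dual process (as defined in the context). Then $\lambda_0=\hat\lambda_1$. (2) Suppose instead that $\sum_{k\in E}\frac1{\mu_ka_k}=\infty$ and $\sum_{i\in E}\mu_i=\infty$. Then $\lambda_0$, as well as $\inf\{D(f):\mu(f^2)=1\}$ (infimum over all such $f$, without the restriction $f\in\mathscr K$), is equal to the dual quantity $\hat\lambda_0$ defined in the context, and all of these are $0$.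
   Context: Setting. $E=\{i\in\mathbb Z:1\le i<N+1\}$, $1\le N\le\infty$, with Dirichlet boundaries at $0$ and, if $N<\infty$, at $N+1$: death rates $a_i>0$ and birth rates $b_i>0$ for all $i\in E$. $\mu_1=1$, $\mu_k=\frac{b_1\cdots b_{k-1}}{a_2\cdots a_k}$ for $2\le k<N+1$; $\mu(f)=\sum_{k\in E}\mu_kf_k$; $\mathscr K$ is the set of finitely supported functions on $E$; $D(f)=\mu_1a_1f_1^2+\sum_{k\in E}\mu_kb_k(f_{k+1}-f_k)^2$, with $f_{N+1}:=0$ if $N<\infty$. Dual process in (1): on $\widehat E$ with birth rates $\hat b_i$ and death rates $\hat a_i$ (so $\hat a_0=0$, and $\hat b_N=0$ if $N<\infty$), $\hat\mu_0=1$, $\hat\mu_n=\frac{\hat b_0\cdots\hat b_{n-1}}{\hat a_1\cdots\hat a_n}$ (then $\sum_n\hat\mu_n<\infty$), $\widehat D(f)=\sum_{1\le i<N+1}\hat\mu_i\hat a_i(f_i-f_{i-1})^2$, and $\hat\lambda_1=\inf\{\widehat D(f):\ f\in L^2(\hat\mu),\ \hat\mu(f)=0,\ \hat\mu(f^2)=1\}$. Dual quantity in (2) (here necessarily $N=\infty$): with the same dual rates $\hat b_i=a_{i+1}$, $\hat a_i=b_i$ ($\hat a_0=0$) on $\{0,1,2,\dots\}$ and the same $\hat\mu$, $\hat\lambda_0=\inf\{\sum_{i\ge0}\hat\mu_i\hat b_i(f_{i+1}-f_i)^2:\ f\text{ finitely supported},\ \hat\mu(f^2)=1\}$. *)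

(* Defs.v *)
From mathcomp Require Import all_boot all_order all_algebra.
From mathcomp Require Import all_classical all_reals all_analysis.

Set Implicit Arguments.
Unset Strict Implicit.
Unset Printing Implicit Defensive.

Import Order.TTheory GRing.Theory Num.Theory.

Local Open Scope classical_set_scope.
Local Open Scope ring_scope.
Local Open Scope ereal_scope.

(* An extended natural number N is an [option nat], with [None] for infinity.
   State spaces are boolean predicates on nat; a function on a state space is
   a function on nat, whose values outside the state space play no role. *)
Definition le_enat (k : nat) (N : option nat) : bool :=
  if N is Some n then (k <= n)%N else true.

Definition states (N : option nat) (i : nat) : bool := (0 < i)%N && le_enat i N.

Definition dual_states (N : option nat) (i : nat) : bool := le_enat i N.

Section BirthDeath.
Context {R : realType}.
Variable N : option nat.
Variables a b : nat -> R.
Implicit Type f : nat -> R.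

Definition mu (k : nat) : R :=
  ((\prod_(1 <= i < k) b i) / (\prod_(2 <= i < k.+1) a i))%R.

Definition mu_total : \bar R := \sum_(k <oo | states N k) (mu k)%:E.

Definition sum_inv_mua : \bar R :=
  \sum_(k <oo | states N k) ((mu k * a k)^-1)%R%:E.

Definition mu_sq f : \bar R := \sum_(k <oo | states N k) (mu k * f k ^+ 2)%R%:E.

Definition finitely_supported f : Prop :=
  finite_set [set k | states N k /\ f k <> 0%R].

Definition dirichlet_ext f (k : nat) : R := if states N k then f k else 0%R.

Definition D f : \bar R :=
  (mu 1 * a 1 * f 1 ^+ 2)%R%:E +
  \sum_(k <oo | states N k)
    (mu k * b k * (dirichlet_ext f k.+1 - f k) ^+ 2)%R%:E.

Definition lambda0 : \bar R :=
  ereal_inf [set D f | f in [set f | mu_sq f = 1 /\ finitely_supported f]].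

Definition lambda0_all : \bar R := ereal_inf [set D f | f in [set f | mu_sq f = 1]].

(* These encode the conventions a_{N+1} := 0 (for finite N) and b_0 := 0. *)
Definition dual_b (i : nat) : R := if states N i.+1 then a i.+1 else 0%R.

Definition dual_a (i : nat) : R := if states N i then b i else 0%R.

Definition dual_mu (n : nat) : R :=
  ((\prod_(0 <= i < n) dual_b i) / (\prod_(1 <= i < n.+1) dual_a i))%R.

Definition dual_mu_sq f : \bar R :=
  \sum_(i <oo | dual_states N i) (dual_mu i * f i ^+ 2)%R%:E.

(* Limit of the partial sums. It is only used for f in L^2(dual_mu) when
   dual_mu is finite, in which case the series converges absolutely. *)
Definition dual_mean f : \bar R :=
  \sum_(i <oo | dual_states N i) (dual_mu i * f i)%R%:E.

Definition dual_D f : \bar R :=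
  \sum_(i <oo | states N i) (dual_mu i * dual_a i * (f i - f i.-1) ^+ 2)%R%:E.

Definition dual_lambda1 : \bar R :=
  ereal_inf [set dual_D f | f in
    [set f | [/\ dual_mu_sq f < +oo, dual_mean f = 0 & dual_mu_sq f = 1]]].

Definition dual_finitely_supported f : Prop :=
  finite_set [set i | dual_states N i /\ f i <> 0%R].

(* For finite N the term i = N vanishes, since then dual_b N = 0. *)
Definition dual_D0 f : \bar R :=
  \sum_(i <oo | dual_states N i)
    (dual_mu i * dual_b i * (f i.+1 - f i) ^+ 2)%R%:E.

Definition dual_lambda0 : \bar R :=
  ereal_inf [set dual_D0 f | f in
    [set f | dual_finitely_supported f /\ dual_mu_sq f = 1]].

End BirthDeath.

(* Main.v *)
Require Import Defs.
From mathcomp Require Import all_boot all_order all_algebra.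
From mathcomp Require Import all_classical all_reals all_analysis.
From mathcomp Require Import ring lra.

(* Since mu_k b_k = a_1 / mu^_k and mu^_k a^_k = a_1 / mu_k, D(f) is a_1 times the
   squared norm in L^2(mu^) of S f := (f_{k+1} - f_k) / mu^_k, with the convention
   f_0 = f_{N+1} = 0, and the dual form is a_1 times the squared norm in L^2(mu)
   of the adjoint S* h = -(h_k - h_{k-1}) / mu_k.
   The two Rayleigh quotients are then compared by Cauchy-Schwarz applied to
   <S f, h> = <f, S* h>: given f, take the h of mean 0 with S* h = f; given h of
   mean 0, take f_k = sum_{j<k} mu^_j h_j, for which S f = h. That f tends to 0
   but need not be finitely supported; composing it with a soft threshold makes
   it so without increasing D, and the threshold is then sent to 0.
   In part (2) both processes are recurrent, and cutoffs that equal 1 up to n and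
   then decrease to 0 in proportion to the weights have arbitrarily small energy. *)

Set Implicit Arguments.
Unset Strict Implicit.
Unset Printing Implicit Defensive.

Import Order.TTheory GRing.Theory Num.Theory.
Import numFieldNormedType.Exports.

Local Open Scope ring_scope.
Local Open Scope ereal_scope.

(** * Finite sums: Cauchy-Schwarz and summation by parts *)

(** Cauchy-Schwarz without square roots or quotients, so vanishing weights are allowed. The
    induction step needs 2 Z z <= X y + x Y; this holds because (Z z)^2 <= (X y)(x Y), by the
    arithmetic-geometric mean inequality. *)
Lemma sqr_sum_le_mul (R : realFieldType) (x y z : nat -> R) (n : nat) :
  (forall i, 0 <= x i)%R -> (forall i, 0 <= y i)%R ->
  (forall i, z i ^+ 2 <= x i * y i)%R ->
  ((\sum_(0 <= i < n) z i) ^+ 2 <=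
   (\sum_(0 <= i < n) x i) * (\sum_(0 <= i < n) y i))%R.
Proof.
move=> x0 y0 zxy; elim: n => [|n IH]; first by rewrite !big_geq//; lra.
rewrite !big_nat_recr//=.
set X := (\sum_(0 <= i < n) x i)%R in IH *.
set Y := (\sum_(0 <= i < n) y i)%R in IH *.
set Z := (\sum_(0 <= i < n) z i)%R in IH *.
have X0 : (0 <= X)%R by apply: sumr_ge0.
have Y0 : (0 <= Y)%R by apply: sumr_ge0.
move: (x0 n) (y0 n) (zxy n) => xn yn zn.
suff : (2 * (Z * z n) <= X * y n + x n * Y)%R by move=> ?; nra.
have S0 : (0 <= X * y n + x n * Y)%R by rewrite addr_ge0// mulr_ge0.
apply: le_trans (ler_norm _) _.
rewrite -(@ler_pXn2r _ 2)// ?nnegrE// real_normK ?num_real//.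
have H : (Z ^+ 2 * z n ^+ 2 <= (X * Y) * (x n * y n))%R.
  by apply: ler_pM => //; exact: sqr_ge0.
have : (0 <= (X * y n - x n * Y) ^+ 2)%R by exact: sqr_ge0.
move=> K; rewrite !exprMn; nra.
Qed.

(** The identity behind <S f, h> = <f, S* h>; the boundary terms vanish once F is 0 at both ends. *)
Lemma sum_by_parts (R : comRingType) (F h : nat -> R) (n : nat) :
  (\sum_(0 <= k < n) (F k.+1 - F k) * h k =
   F n * h n - F 0%N * h 0%N - \sum_(0 <= k < n) F k.+1 * (h k.+1 - h k))%R.
Proof.
elim: n => [|n IH]; first by rewrite !big_geq//; ring.
by rewrite !big_nat_recr//= IH; ring.
Qed.

Lemma le_term_sum (R : numDomainType) (u : nat -> R) j n :
  (forall i, 0 <= u i)%R -> (j < n)%N ->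
  (u j <= \sum_(0 <= i < n) u i)%R.
Proof.
move=> u0 jn; rewrite big_mkord (bigD1 (Ordinal jn))//= lerDl.
exact: sumr_ge0.
Qed.

Lemma finite_set_nat_ub (A : set nat) :
  finite_set A -> exists n, forall k, (n <= k)%N -> ~ A k.
Proof.
move=> /finite_seqP[s ->]; exists (\max_(i <- s) i).+1 => k nk /= ks.
by move: nk; rewrite ltnNge (@leq_bigmax_seq _ s xpredT (fun i => i)).
Qed.

(** * Real series viewed in the extended reals *)

Section real_series.
Context {R : realType}.
Implicit Types (u : nat -> R) (P : pred nat).

Lemma eseries_zero_ext P u :
  \sum_(k <oo | P k) (u k)%:E = \sum_(k <oo) (if P k then u k else 0%R)%:E.
Proof. by rewrite eseries_mkcond; apply: eq_eseriesr => k _; case: ifP. Qed.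

Lemma partial_sum_le_nneseries u n : (forall i, 0 <= u i)%R ->
  (\sum_(0 <= i < n) u i)%:E <= \sum_(i <oo) (u i)%:E.
Proof.
move=> u0; rewrite -sumEFin; apply: (@nneseries_lim_ge _ _ xpredT) => i _ _.
by rewrite lee_fin.
Qed.

Lemma nneseries_le_of_partial_sums u (c : R) : (forall i, 0 <= u i)%R ->
  (forall n, \sum_(0 <= i < n) u i <= c)%R -> \sum_(i <oo) (u i)%:E <= c%:E.
Proof.
move=> u0 uc; apply: lime_le.
  by apply: is_cvg_nneseries => i _ _; rewrite lee_fin.
by apply: nearW => n; rewrite sumEFin lee_fin.
Qed.

Lemma partial_sum_gt u (c : R) : (forall i, 0 <= u i)%R ->
  c%:E < \sum_(i <oo) (u i)%:E -> exists n, (c < \sum_(0 <= i < n) u i)%R.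
Proof.
move=> u0 cu; apply/not_existsP => H.
have /(nneseries_le_of_partial_sums u0) : (forall n, \sum_(0 <= i < n) u i <= c)%R.
  by move=> n; rewrite leNgt; apply/negP/H.
by rewrite leNgt cu.
Qed.

Lemma nneseries_fineK u : (forall i, 0 <= u i)%R ->
  \sum_(i <oo) (u i)%:E < +oo ->
  (fine (\sum_(i <oo) (u i)%:E))%:E = \sum_(i <oo) (u i)%:E.
Proof.
move=> u0 uoo; rewrite fineK// ge0_fin_numE//.
by apply: nneseries_ge0 => i _ _; rewrite lee_fin.
Qed.

Lemma nneseries_finite_support u n : (forall i, 0 <= u i)%R ->
  (forall i, (n <= i)%N -> u i = 0%R) ->
  \sum_(i <oo) (u i)%:E = (\sum_(0 <= i < n) u i)%:E.
Proof.
move=> u0 un; rewrite (nneseries_split _ n) ?add0n; last by move=> k; rewrite lee_fin.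
rewrite eseries0 ?adde0 ?sumEFin// => i ni _.
by rewrite un.
Qed.

Lemma nneseries_scale (c : R) u P : (forall i, 0 <= u i)%R ->
  \sum_(i <oo | P i) (c * u i)%:E = c%:E * \sum_(i <oo | P i) (u i)%:E.
Proof.
move=> u0; rewrite -nneseriesZl; last by move=> i _; rewrite lee_fin.
by apply: eq_eseriesr => i _; rewrite EFinM.
Qed.

Lemma nneseries_cvg u : (forall i, 0 <= u i)%R ->
  \sum_(i <oo) (u i)%:E < +oo -> cvgn (series u).
Proof.
move=> u0 uoo; apply: nondecreasing_is_cvgn.
  by apply/nondecreasing_seqP => n; rewrite seriesSr lerDl.
exists (fine (\sum_(i <oo) (u i)%:E)) => _ [n _ <-].
by rewrite -lee_fin nneseries_fineK// /series/= partial_sum_le_nneseries.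
Qed.

Lemma eseries_lim u (l : R) :
  (series u @ \oo --> l)%classic -> \sum_(i <oo) (u i)%:E = l%:E.
Proof.
move=> ul; apply/cvg_lim => //.
rewrite (_ : (fun n => _) = EFin \o series u); last first.
  by apply/funext => n; rewrite /= sumEFin.
exact: cvg_comp ul _.
Qed.

Lemma series_cvg_add_scale (u v : nat -> R) (c l m : R) :
  (series u @ \oo --> l)%classic -> (series v @ \oo --> m)%classic ->
  (series (fun i => u i + c * v i)%R @ \oo --> (l + c * m)%R)%classic.
Proof.
move=> ul vm.
rewrite (_ : series _ = (fun n => series u n + c * series v n)%R).
  by apply: cvgD => //; exact: cvgMl_tmp.
by apply/funext => n; rewrite /series/= mulr_sumr -big_split.
Qed.

(** For a finite weight, L^2 is contained in L^1: |h| <= 1 + h^2 gives the summable majorant p + p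
    h^2. *)
Lemma weighted_mean_cvg (p h : nat -> R) : (forall i, 0 <= p i)%R ->
  \sum_(i <oo) (p i)%:E < +oo -> \sum_(i <oo) (p i * h i ^+ 2)%:E < +oo ->
  cvgn (series (fun i => p i * h i)%R).
Proof.
move=> p0 p1 ph2.
have ph20 i : (0 <= p i * h i ^+ 2)%R by rewrite mulr_ge0 ?sqr_ge0.
apply: normed_cvg.
apply: (@series_le_cvg _ _ (fun i => p i + p i * h i ^+ 2)%R).
- by move=> i; exact: normr_ge0.
- by move=> i; rewrite addr_ge0.
- move=> i /=; rewrite normrM (ger0_norm (p0 i)) -{2}(mulr1 (p i)) -mulrDr.
  apply: ler_wpM2l => //.
  rewrite -[X in (_ <= _ + X)%R]real_normK ?num_real//.
  have := sqr_ge0 (`|h i| - 1)%R; have := normr_ge0 (h i); nra.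
- apply: nneseries_cvg => [i|]; first by rewrite addr_ge0.
  under eq_eseriesr do rewrite EFinD.
  by rewrite nneseriesD ?lte_add_pinfty// => i _ _; rewrite lee_fin.
Qed.

End real_series.

(** * Soft thresholding *)

Section soft_threshold.
Context {R : realFieldType}.
Implicit Types e x y : R.

(** The point x minus its projection onto [-e, e]: zero on that interval, a shift by e towards 0
    outside it. *)
Definition soft_threshold e x : R := (x - Num.max (- e) (Num.min e x))%R.

Lemma soft_threshold0 e x : (`|x| <= e)%R -> soft_threshold e x = 0%R.
Proof.
rewrite ler_norml => /andP[ex xe].
by rewrite /soft_threshold (min_idPr xe) (max_idPr ex) subrr.
Qed.

Lemma soft_threshold_dist e x : (0 <= e)%R -> (`|x - soft_threshold e x| <= e)%R.
Proof.
move=> e0; rewrite /soft_threshold opprB addrC subrK ler_norml.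
by rewrite le_max lexx/= ge_max ge_min lexx/= andbT; lra.
Qed.

Lemma soft_threshold_cases e x : (0 <= e)%R ->
  [\/ (x <= - e)%R /\ soft_threshold e x = (x + e)%R,
      (- e <= x <= e)%R /\ soft_threshold e x = 0%R |
      (e <= x)%R /\ soft_threshold e x = (x - e)%R].
Proof.
move=> e0; have [ex|xe] := leP e x.
  apply: Or33; split => //.
  by rewrite /soft_threshold (min_idPl ex) (max_idPr _)//; lra.
have [xNe|Nex] := leP x (- e)%R.
  apply: Or31; split => //.
  by rewrite /soft_threshold (min_idPr (ltW xe)) (max_idPl xNe) opprK.
apply: Or32; rewrite soft_threshold0 ?(ltW Nex) ?(ltW xe)//.
by rewrite ler_norml !ltW.
Qed.

(** Monotonicity and the Lipschitz bound 1 in one factor t: t <= 1 controls the energy, t >= 0 the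
    sign of the pairing with h. *)
Lemma soft_thresholdB e x y : (0 <= e)%R ->
  exists2 t, (0 <= t <= 1)%R &
    (soft_threshold e x - soft_threshold e y = t * (x - y))%R.
Proof.
move=> e0; have [->|xy] := eqVneq x y.
  by exists 0%R; [lra|rewrite !subrr mulr0].
exists ((soft_threshold e x - soft_threshold e y) / (x - y))%R; last first.
  by rewrite divfK// subr_eq0.
have [lt_xy|lt_yx] := ltP x y.
  rewrite ler_ndivrMr ?ler_ndivlMr; try lra.
  case: (soft_threshold_cases x e0) => -[? ->];
    case: (soft_threshold_cases y e0) => -[? ->]; lra.
have {xy}lt_yx : (y < x)%R by rewrite lt_neqAle eq_sym xy.
rewrite ler_pdivrMr ?ler_pdivlMr; try lra.
case: (soft_threshold_cases x e0) => -[? ->];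
  case: (soft_threshold_cases y e0) => -[? ->]; lra.
Qed.

End soft_threshold.

(** * Competitors for Rayleigh quotients *)

(** Divide f by the square root of Q f. The form E, the squared norm Q and the constraint P are
    abstract because three different quotients are normalized this way. *)
Lemma exists_normalized (R : realType) (P : (nat -> R) -> Prop)
    (Q E : (nat -> R) -> \bar R) (f : nat -> R) (v d : R) :
  (forall c g, Q (fun i => c * g i)%R = (c ^+ 2)%:E * Q g) ->
  (forall c g, E (fun i => c * g i)%R = (c ^+ 2)%:E * E g) ->
  (forall c g, P g -> P (fun i => c * g i)%R) ->
  P f -> (0 < v)%R -> (0 <= d)%R ->
  v%:E <= Q f -> Q f < +oo -> E f <= d%:E ->
  exists g, [/\ P g, Q g = 1 & E g <= (d / v)%:E].
Proof.
move=> QZ EZ PZ Pf v0 d0; case QfE : (Q f) => [V| |]//.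
rewrite lee_fin => vV _ Ed.
have V0 : (0 < V)%R by exact: lt_le_trans v0 vV.
exists (fun i => (Num.sqrt V)^-1 * f i)%R; split; first exact: PZ.
  by rewrite QZ QfE exprVn sqr_sqrtr ?(ltW V0)// -EFinM mulVf ?gt_eqF.
rewrite EZ exprVn sqr_sqrtr ?(ltW V0)//.
apply: (@le_trans _ _ ((V^-1)%:E * d%:E)).
  by apply: lee_wpmul2l => //; rewrite lee_fin invr_ge0 ltW.
by rewrite -EFinM lee_fin mulrC ler_wpM2l// lef_pV2.
Qed.

(** The cutoff descends from 1 at n to 0 at m with steps w_k / T, where T is the weight of [n, m).
    Its energy is the sum of w_k / T^2, that is 1 / T, and divergence allows T > 1 / e. *)
Lemma exists_cutoff (R : realType) (w : nat -> R) (n : nat) (e : R) :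
  (forall k, 0 <= w k)%R -> (0 < e)%R -> \sum_(k <oo) (w k)%:E = +oo ->
  exists g : nat -> R, exists m, [/\ forall k, (k <= n)%N -> g k = 1%R,
    forall k, (m <= k)%N -> g k = 0%R &
    \sum_(k <oo) ((g k.+1 - g k) ^+ 2 / w k)%:E <= e%:E].
Proof.
move=> w0 e0 woo.
have [m wm] : exists m, (\sum_(0 <= k < n) w k + e^-1 < \sum_(0 <= k < m) w k)%R.
  by apply: partial_sum_gt => //; rewrite woo ltry.
have ie0 : (0 < e^-1)%R by rewrite invr_gt0.
have nm : (n <= m)%N.
  rewrite leqNgt; apply/negP => mn; move: wm.
  rewrite (big_cat_nat (n := m) (p := n))//= ?(ltnW mn)//.
  have : (0 <= \sum_(m <= k < n) w k)%R by apply: sumr_ge0.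
  lra.
pose T := (\sum_(n <= k < m) w k)%R.
have Te : (e^-1 < T)%R.
  by move: wm; rewrite (big_cat_nat (n := n) (p := m))//= ltrD2l.
have T0 : (0 < T)%R by exact: lt_trans Te.
(* The maximum with n keeps g equal to T / T = 1 up to n. *)
pose g k := ((\sum_(maxn k n <= j < m) w j) / T)%R.
have gm k : (m <= k)%N -> g k = 0%R.
  by move=> mk; rewrite /g big_geq ?mul0r// leq_max mk.
have t0 k : (0 <= (g k.+1 - g k) ^+ 2 / w k)%R by rewrite divr_ge0 ?sqr_ge0.
exists g, m; split => //.
  by move=> k kn; rewrite /g (maxn_idPr kn) divff// gt_eqF.
rewrite (nneseries_finite_support (n := m))//; last first.
  by move=> k mk; rewrite !gm ?(leqW mk)// subrr expr0n mul0r.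
rewrite lee_fin (big_cat_nat (n := n))//= big_nat_cond big1 ?add0r; last first.
  move=> k /andP[/andP[_ kn] _].
  by rewrite /g (maxn_idPr kn) (maxn_idPr (ltnW kn)) subrr expr0n mul0r.
apply: (@le_trans _ _ (\sum_(n <= k < m) w k / T ^+ 2)%R); last first.
  rewrite -mulr_suml -/T expr2 invfM mulVKf ?gt_eqF//.
  by rewrite invf_ple ?posrE// ltW.
rewrite big_nat [leRHS]big_nat; apply: ler_sum => k /andP[nk km].
rewrite /g (maxn_idPl nk) (maxn_idPl (leqW nk)) (big_ltn km).
(* Where w k = 0, both sides are 0, by the convention that 0 has inverse 0. *)
have [->|wk] := eqVneq (w k) 0%R; first by rewrite invr0; lra.
by rewrite le_eqVlt; apply/orP; left; apply/eqP; field; rewrite wk gt_eqF.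
Qed.

(** * The dual weights and the forms written with them *)

Section birth_death_duality.
Context {R : realType} (N : option nat) (a b : nat -> R).
Context (hN : le_enat 1 N).
Context (ha : forall i : nat, states N i -> (0 < a i)%R).
Context (hb : forall i : nat, states N i -> (0 < b i)%R).
Implicit Types (f h : nat -> R) (k n : nat).

(** Both weights are extended by 0 so that every series can run over all of nat. *)
Definition mu_ext k : R := if states N k then mu a b k else 0%R.

Definition dual_mu_ext k : R :=
  if dual_states N k then dual_mu N a b k else 0%R.

Lemma le_enat_trans k n : (k <= n)%N -> le_enat n N -> le_enat k N.
Proof. by rewrite /le_enat; case: N => // m; exact: leq_trans. Qed.

Lemma states0 : states N 0 = false. Proof. by []. Qed.

Lemma statesS k : states N k.+1 = dual_states N k.+1. Proof. by []. Qed.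

Lemma states1 : states N 1. Proof. by []. Qed.

Lemma dual_statesW k : dual_states N k.+1 -> dual_states N k.
Proof. exact: le_enat_trans. Qed.

Lemma dual_states0 : dual_states N 0.
Proof. exact: dual_statesW states1. Qed.

Lemma a1_gt0 : (0 < a 1)%R. Proof. exact: ha. Qed.

Lemma mu1 : mu a b 1 = 1%R.
Proof. by rewrite /mu !big_geq// divr1. Qed.

Lemma dual_mu0 : dual_mu N a b 0 = 1%R.
Proof. by rewrite /dual_mu !big_geq// divr1. Qed.

(** Detailed balance, the source of the duality together with its counterpart for [dual_mu]. *)
Lemma muS k : (0 < k)%N -> states N k.+1 ->
  (mu a b k.+1 * a k.+1 = mu a b k * b k)%R.
Proof.
move=> k0 sk; rewrite /mu big_nat_recr//= (big_nat_recr k.+1)//= invfM.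
by rewrite -!mulrA mulVf ?mulr1; [rewrite (mulrC (b k))|rewrite gt_eqF ?ha].
Qed.

Lemma dual_muS k : states N k.+1 ->
  (dual_mu N a b k.+1 * b k.+1 = dual_mu N a b k * a k.+1)%R.
Proof.
move=> sk; rewrite /dual_mu big_nat_recr//= (big_nat_recr k.+1)//= invfM.
rewrite {2}/dual_a {2}/dual_b sk -!mulrA mulVf ?mulr1; last by rewrite gt_eqF ?hb.
by rewrite (mulrC (a _)).
Qed.

(** The product is constant in k: by detailed balance mu_k a_k gains the factor b_k / a_k from k to
    k+1, and [dual_mu] gains the inverse factor. At the start it equals a_1. *)
Lemma mu_a_dual_mu k : states N k.+1 ->
  (mu a b k.+1 * a k.+1 * dual_mu N a b k = a 1)%R.
Proof.
elim: k => [|k IH] sk; first by rewrite mu1 dual_mu0 mulr1 mul1r.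
have sk' : states N k.+1 by exact: dual_statesW sk.
by rewrite muS// -mulrA (mulrC (b _)) dual_muS// mulrCA mulrA mulrC mulrA mulrAC
  (mulrC _ (mu a b _)) IH.
Qed.

Lemma mu_b_dual_mu k : states N k ->
  (mu a b k * b k * dual_mu N a b k = a 1)%R.
Proof.
case: k => // k sk; rewrite -mulrA (mulrC (b _)) dual_muS//.
by rewrite mulrCA mulrA mulrAC mulrC mulrA -(mu_a_dual_mu sk); ring.
Qed.

Lemma mu_gt0 k : states N k -> (0 < mu a b k)%R.
Proof.
case: k => // k; elim: k => [|k IH] sk; first by rewrite mu1.
have sk' : states N k.+1 by exact: dual_statesW sk.
by rewrite -(pmulr_lgt0 _ (ha sk)) muS// mulr_gt0 ?IH ?hb.
Qed.

Lemma dual_mu_gt0 k : dual_states N k -> (0 < dual_mu N a b k)%R.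
Proof.
elim: k => [|k IH] sk; first by rewrite dual_mu0.
rewrite -(pmulr_lgt0 _ (hb (sk : states N k.+1))) dual_muS//.
by rewrite mulr_gt0 ?ha// IH// dual_statesW.
Qed.

Lemma mu_ext0 : mu_ext 0 = 0%R. Proof. by []. Qed.

Lemma mu_ext_ge0 k : (0 <= mu_ext k)%R.
Proof. by rewrite /mu_ext; case: ifP => // /mu_gt0/ltW. Qed.

Lemma dual_mu_ext_ge0 k : (0 <= dual_mu_ext k)%R.
Proof. by rewrite /dual_mu_ext; case: ifP => // /dual_mu_gt0/ltW. Qed.

Lemma mu_totalE : mu_total N a b = \sum_(k <oo) (mu_ext k)%:E.
Proof. exact: eseries_zero_ext. Qed.

Lemma mu_sqE f : mu_sq N a b f = \sum_(k <oo) (mu_ext k * f k ^+ 2)%:E.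
Proof.
rewrite /mu_sq eseries_zero_ext; apply: eq_eseriesr => k _.
by rewrite /mu_ext; case: ifP => //; rewrite mul0r.
Qed.

Lemma dual_mu_sqE h :
  dual_mu_sq N a b h = \sum_(k <oo) (dual_mu_ext k * h k ^+ 2)%:E.
Proof.
rewrite /dual_mu_sq eseries_zero_ext; apply: eq_eseriesr => k _.
by rewrite /dual_mu_ext; case: ifP => //; rewrite mul0r.
Qed.

Lemma dual_meanE h :
  dual_mean N a b h = \sum_(k <oo) (dual_mu_ext k * h k)%:E.
Proof.
rewrite /dual_mean eseries_zero_ext; apply: eq_eseriesr => k _.
by rewrite /dual_mu_ext; case: ifP => //; rewrite mul0r.
Qed.

(* Outside the state space [mu_ext] is 0, hence so is its inverse. *)
Lemma dual_DE h : dual_D N a b h =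
  \sum_(k <oo) (a 1 / mu_ext k * (h k - h k.-1) ^+ 2)%:E.
Proof.
rewrite /dual_D eseries_zero_ext; apply: eq_eseriesr => k _.
rewrite /mu_ext /dual_a; case: ifP => sk; last by rewrite invr0 mulr0 mul0r.
rewrite -(mu_b_dual_mu sk); congr (_ * _)%:E.
by rewrite sk; field; rewrite gt_eqF ?mu_gt0.
Qed.

(** The boundary term of D becomes the term k = 0, since the Dirichlet extension is 0 at 0 and
    [dual_mu] is 1 there. Beyond the dual states the inverse of the zero weight removes the
    terms. *)
Lemma DE f : D N a b f = \sum_(k <oo)
  (a 1 / dual_mu_ext k *
   (dirichlet_ext N f k.+1 - dirichlet_ext N f k) ^+ 2)%:E.
Proof.
have t0 k : (0 <= a 1 / dual_mu_ext k *
   (dirichlet_ext N f k.+1 - dirichlet_ext N f k) ^+ 2)%R.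
  by rewrite mulr_ge0 ?sqr_ge0 ?divr_ge0 ?dual_mu_ext_ge0// ltW// a1_gt0.
rewrite nneseries_recl//; last by move=> k _; rewrite lee_fin.
rewrite /D eseries_zero_ext nneseries_recl//; last first.
  move=> k _; rewrite lee_fin; case: ifP => // sk.
  by rewrite mulr_ge0 ?sqr_ge0// mulr_ge0// ltW ?mu_gt0 ?hb.
rewrite states0 add0e; congr (_ + _).
  rewrite mu1 /dual_mu_ext dual_states0 dual_mu0 /dirichlet_ext states1 /=.
  by rewrite subr0 divr1 mul1r.
rewrite eseries_cond [RHS]eseries_cond; apply: eq_eseriesr => -[|k]//= _.
rewrite /dual_mu_ext -statesS; case: ifP => sk; last by rewrite invr0 mulr0 mul0r.
rewrite -(mu_b_dual_mu sk) {3}/dirichlet_ext sk; congr (_ * _)%:E.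
by field; rewrite gt_eqF ?dual_mu_gt0.
Qed.

(** After a shift of the index, 1 / (mu_{k+1} a_{k+1}) is dual_mu_k / a_1. For finite N the top
    weight, at k = N, is missing from the sum. *)
Lemma sum_inv_muaE : sum_inv_mua N a b =
  \sum_(k <oo) (if states N k.+1 then dual_mu N a b k / a 1 else 0)%:E.
Proof.
rewrite /sum_inv_mua eseries_zero_ext nneseries_recl//; last first.
  move=> k _; rewrite lee_fin; case: ifP => // sk.
  by rewrite invr_ge0 mulr_ge0 ?ltW ?mu_gt0 ?ha.
rewrite add0e.
rewrite -(@nneseries_addn _
  (fun k => (if states N k then (mu a b k * a k)^-1 else 0)%:E) 1); last first.
  move=> k; rewrite lee_fin; case: ifP => // sk.
  by rewrite invr_ge0 mulr_ge0 ?ltW ?mu_gt0 ?ha.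
apply: eq_eseriesr => k _; rewrite addn1; case: ifP => // sk.
rewrite -(mu_a_dual_mu sk); congr (_%:E); field.
by rewrite !gt_eqF ?mu_gt0 ?ha// dual_mu_gt0// dual_statesW.
Qed.

Lemma dual_mu_summable : sum_inv_mua N a b < +oo ->
  \sum_(k <oo) (dual_mu_ext k)%:E < +oo.
Proof.
(* Finite N is treated apart: the hypothesis does not see the weight at N, but the sum is finite
   anyway. *)
rewrite sum_inv_muaE => soo; case NE : N => [n|].
  rewrite (nneseries_finite_support (n := n.+1)) ?ltry// => [|i ni].
    exact: dual_mu_ext_ge0.
  by rewrite /dual_mu_ext /dual_states NE /= leqNgt ni.
suff -> : \sum_(k <oo) (dual_mu_ext k)%:E = (a 1)%:E *
    \sum_(k <oo) (if states N k.+1 then dual_mu N a b k / a 1 else 0)%:E.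
  by rewrite lte_mul_pinfty// lee_fin ltW ?a1_gt0.
rewrite -nneseriesZl => [|k _].
  apply: eq_eseriesr => k _; rewrite /dual_mu_ext NE /= -EFinM mulrC divfK//.
  by rewrite gt_eqF ?a1_gt0.
rewrite lee_fin; case: ifP => // sk; rewrite divr_ge0 ?ltW ?a1_gt0//.
by rewrite dual_mu_gt0// dual_statesW.
Qed.

(** * Homogeneity and upper bounds by Rayleigh quotients *)

Lemma mu_sqZ (c : R) f :
  mu_sq N a b (fun i => c * f i)%R = (c ^+ 2)%:E * mu_sq N a b f.
Proof.
rewrite !mu_sqE -nneseries_scale => [|i]; last first.
  by rewrite mulr_ge0 ?mu_ext_ge0 ?sqr_ge0.
by apply: eq_eseriesr => i _; congr (_%:E); ring.
Qed.

Lemma DZ (c : R) f : D N a b (fun i => c * f i)%R = (c ^+ 2)%:E * D N a b f.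
Proof.
rewrite !DE -nneseries_scale => [|i]; last first.
  by rewrite mulr_ge0 ?sqr_ge0 ?divr_ge0 ?dual_mu_ext_ge0// ltW// a1_gt0.
apply: eq_eseriesr => i _; congr (_%:E); rewrite /dirichlet_ext.
by do 2!case: ifP => _; ring.
Qed.

Lemma dual_mu_sqZ (c : R) h :
  dual_mu_sq N a b (fun i => c * h i)%R = (c ^+ 2)%:E * dual_mu_sq N a b h.
Proof.
rewrite !dual_mu_sqE -nneseries_scale => [|i]; last first.
  by rewrite mulr_ge0 ?dual_mu_ext_ge0 ?sqr_ge0.
by apply: eq_eseriesr => i _; congr (_%:E); ring.
Qed.

Lemma dual_DZ (c : R) h :
  dual_D N a b (fun i => c * h i)%R = (c ^+ 2)%:E * dual_D N a b h.
Proof.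
rewrite !dual_DE -nneseries_scale => [|i]; last first.
  by rewrite mulr_ge0 ?sqr_ge0 ?divr_ge0 ?mu_ext_ge0// ltW// a1_gt0.
by apply: eq_eseriesr => i _; congr (_%:E); ring.
Qed.

Lemma finitely_supportedZ (c : R) f :
  finitely_supported N f -> finitely_supported N (fun i => c * f i)%R.
Proof.
by apply: sub_finite_set => k [sk cf]; split => // fk0; apply: cf; rewrite fk0 mulr0.
Qed.

Lemma lambda0_le f (v d : R) : finitely_supported N f ->
  (0 < v)%R -> (0 <= d)%R -> v%:E <= mu_sq N a b f -> mu_sq N a b f < +oo ->
  D N a b f <= d%:E -> lambda0 N a b <= (d / v)%:E.
Proof.
move=> ff v0 d0 vf foo Df.
have [g [fg g1 Dg]] := exists_normalized mu_sqZ DZ finitely_supportedZ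
  ff v0 d0 vf foo Df.
by apply: le_trans Dg; apply: ereal_inf_lbound; exists g.
Qed.

Lemma finitely_supported_ub f : finitely_supported N f ->
  exists n, forall k, (n <= k)%N -> dirichlet_ext N f k = 0%R.
Proof.
move=> /finite_set_nat_ub[n fn]; exists n => k /fn nk.
rewrite /dirichlet_ext; case: ifP => // sk.
by apply/eqP/negP => /negP/eqP fk; apply: nk.
Qed.

(** Such an h is bounded: K, the sum of its first n+1 squares, dominates every h_i^2. *)
Lemma dual_mu_sq_eventually_constant h n :
  \sum_(k <oo) (dual_mu_ext k)%:E < +oo ->
  (forall i, (n <= i)%N -> h i = h n) -> dual_mu_sq N a b h < +oo.
Proof.
move=> soo hn; rewrite dual_mu_sqE.
pose K := (\sum_(0 <= i < n.+1) h i ^+ 2)%R.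
have K0 : (0 <= K)%R by apply: sumr_ge0 => i _; exact: sqr_ge0.
apply: (@le_lt_trans _ _ (K%:E * \sum_(k <oo) (dual_mu_ext k)%:E)); last first.
  by rewrite lte_mul_pinfty.
rewrite -nneseries_scale; last exact: dual_mu_ext_ge0.
apply: lee_nneseries => [i _ _|i _].
  by rewrite lee_fin mulr_ge0 ?sqr_ge0 ?dual_mu_ext_ge0.
rewrite lee_fin mulrC ler_wpM2r ?dual_mu_ext_ge0//.
have [ni|/ltnW ni] := leqP n i.
  rewrite hn//; apply: (le_term_sum (u := fun i => h i ^+ 2)%R) => // j.
  exact: sqr_ge0.
apply: (le_term_sum (u := fun i => h i ^+ 2)%R) => // j.
exact: sqr_ge0.
Qed.

(** Mean 0 is phrased as convergence of a real series, which scaling visibly preserves; [dual_mean]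
    is recovered from it at the end. *)
Lemma dual_lambda1_le h (v d : R) :
  (series (fun i => dual_mu_ext i * h i)%R @ \oo --> 0%R)%classic ->
  (0 < v)%R -> (0 <= d)%R ->
  v%:E <= dual_mu_sq N a b h -> dual_mu_sq N a b h < +oo ->
  dual_D N a b h <= d%:E -> dual_lambda1 N a b <= (d / v)%:E.
Proof.
move=> h0 v0 d0 vh hoo Dh.
pose P h := (series (fun i => dual_mu_ext i * h i)%R @ \oo --> 0%R)%classic.
have PZ (c : R) g : P g -> P (fun i => c * g i)%R.
  rewrite /P => g0.
  rewrite (_ : series _ = (fun n => c * series (fun i => dual_mu_ext i * g i) n)%R).
    by rewrite -(mulr0 c); exact: cvgMl_tmp.
  by apply/funext => n; rewrite /series/= mulr_sumr; apply: eq_bigr => i _; ring.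
have [g [Pg g1 Dg]] := exists_normalized dual_mu_sqZ dual_DZ PZ h0 v0 d0 vh hoo Dh.
apply: le_trans Dg; apply: ereal_inf_lbound; exists g => //; split => //.
  by rewrite g1 ltry.
by rewrite dual_meanE; exact: eseries_lim.
Qed.

Lemma D_ge0 f : 0 <= D N a b f.
Proof.
rewrite DE; apply: nneseries_ge0 => k _ _; rewrite lee_fin.
by rewrite mulr_ge0 ?sqr_ge0 ?divr_ge0 ?dual_mu_ext_ge0// ltW// a1_gt0.
Qed.

Lemma dual_D_ge0 h : 0 <= dual_D N a b h.
Proof.
rewrite dual_DE; apply: nneseries_ge0 => k _ _; rewrite lee_fin.
by rewrite mulr_ge0 ?sqr_ge0 ?divr_ge0 ?mu_ext_ge0// ltW// a1_gt0.
Qed.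

(** * Part (1): the dual eigenvalue is at most that of the original process *)

Lemma mu_ext_dirichlet_ext f k :
  (mu_ext k * dirichlet_ext N f k ^+ 2 = mu_ext k * f k ^+ 2)%R.
Proof. by rewrite /mu_ext /dirichlet_ext; case: ifP => //; rewrite !mul0r. Qed.

(** With S* h = f and h of mean 0, the dual energy of h is a_1 mu(f^2) = a_1. Cauchy-Schwarz on <S
    f, h> = 1 gives a_1 <= D(f) V with V the squared norm of h, so the dual quotient a_1 / V is at
    most D(f). *)
Lemma dual_lambda1_le_D f : sum_inv_mua N a b < +oo ->
  finitely_supported N f -> mu_sq N a b f = 1 ->
  dual_lambda1 N a b <= D N a b f.
Proof.
move=> /dual_mu_summable soo ff f1.
have [n Fn] := finitely_supported_ub ff.
set F := dirichlet_ext N f in Fn.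
have F0 : F 0%N = 0%R by [].
(* H solves S* H = f. It is constant from n on, where f vanishes, hence square summable for the
   finite weight. *)
pose H i := (- \sum_(0 <= j < i.+1) mu_ext j * F j)%R.
have HS i : (H i.+1 - H i = - (mu_ext i.+1 * F i.+1))%R.
  by rewrite /H big_nat_recr//=; ring.
have Hn i : (n <= i)%N -> H i = H n.
  elim: i => [|i IH]; first by rewrite leqn0 => /eqP ->.
  rewrite leq_eqVlt => /predU1P[->//|]; rewrite ltnS => ni.
  have := HS i; rewrite Fn ?(leqW ni)// mulr0 oppr0 IH// => /eqP.
  by rewrite subr_eq0 => /eqP.
have Hoo := dual_mu_sq_eventually_constant soo Hn.
have /cvg_ex[/= l Hl] : cvgn (series (fun i => dual_mu_ext i * H i)%R).
  apply: weighted_mean_cvg => //; first exact: dual_mu_ext_ge0.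
  by rewrite -dual_mu_sqE.
have /cvg_ex[/= M pM] := nneseries_cvg dual_mu_ext_ge0 soo.
have M0 : (0 < M)%R.
  rewrite -lte_fin -(eseries_lim pM).
  apply: lt_le_trans (partial_sum_le_nneseries 1 dual_mu_ext_ge0).
  by rewrite big_nat1 lte_fin /dual_mu_ext dual_states0 dual_mu0.
(* Subtracting the mean l / M leaves the increments, and so S* H = f, unchanged. *)
pose h i := (H i - l / M)%R.
have h0 : (series (fun i => dual_mu_ext i * h i)%R @ \oo --> 0%R)%classic.
  rewrite [X in (_ --> X)%classic](_ : _ = (l + - (l / M) * M)%R); last first.
    by field; rewrite gt_eqF.
  rewrite (_ : series _ = series (fun i => dual_mu_ext i * H i +
      - (l / M) * dual_mu_ext i)%R); first exact: series_cvg_add_scale.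
  by congr series; apply/funext => i; rewrite /h; ring.
have hS i : (h i.+1 - h i = - (mu_ext i.+1 * F i.+1))%R.
  by rewrite -HS /h; ring.
have hoo : dual_mu_sq N a b h < +oo.
  by apply: dual_mu_sq_eventually_constant soo _ => i ni; rewrite /h (Hn i).
have Dh : dual_D N a b h = (a 1)%:E.
  rewrite dual_DE -[RHS]mule1 -f1 mu_sqE -nneseries_scale; last first.
    by move=> i; rewrite mulr_ge0 ?sqr_ge0 ?mu_ext_ge0.
  apply: eq_eseriesr => -[|k] _ /=.
    by rewrite mu_ext0 subrr mul0r expr0n !mulr0.
  rewrite hS -mu_ext_dirichlet_ext -/F; congr (_%:E).
  have [->|q0] := eqVneq (mu_ext k.+1) 0%R; first by rewrite invr0; ring.
  by field.
case DfE : (D N a b f) => [d| |]; [|by rewrite leey|by have := D_ge0 f; rewrite DfE].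
have p20 i : (0 <= dual_mu_ext i * h i ^+ 2)%R.
  by rewrite mulr_ge0 ?dual_mu_ext_ge0 ?sqr_ge0.
have D0 i : (0 <= a 1 / dual_mu_ext i * (F i.+1 - F i) ^+ 2)%R.
  by rewrite mulr_ge0 ?sqr_ge0 ?divr_ge0 ?dual_mu_ext_ge0// ltW// a1_gt0.
pose V := fine (dual_mu_sq N a b h).
have VE : V%:E = dual_mu_sq N a b h.
  by rewrite /V dual_mu_sqE nneseries_fineK// -dual_mu_sqE.
(* <S f, h> = <f, S* h> = mu(f^2) = 1, by summation by parts. *)
have S1 : (\sum_(0 <= k < n) (F k.+1 - F k) * h k = 1)%R.
  rewrite sum_by_parts F0 Fn// !mul0r subrr sub0r -sumrN.
  apply/EFin_inj; rewrite -f1 mu_sqE (nneseries_finite_support (n := n.+1)).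
  - rewrite big_nat_recl//= mu_ext0 mul0r add0r.
    congr (_%:E); apply: eq_bigr => k _.
    by rewrite hS -mu_ext_dirichlet_ext -/F; ring.
  - by move=> i; rewrite mulr_ge0 ?sqr_ge0 ?mu_ext_ge0.
  - by move=> i ni; rewrite -mu_ext_dirichlet_ext -/F Fn ?(ltnW ni)// expr0n mulr0.
have CS : (a 1 <= d * V)%R.
  have := @sqr_sum_le_mul _
    (fun i => a 1 / dual_mu_ext i * (F i.+1 - F i) ^+ 2)%R
    (fun i => dual_mu_ext i * h i ^+ 2 / a 1)%R
    (fun k => (F k.+1 - F k) * h k)%R n D0.
  rewrite S1 expr1n -mulr_suml mulrA ler_pdivlMr ?a1_gt0// mul1r => CS.
  apply: le_trans (CS _ _) _.
  - by move=> i; rewrite divr_ge0// ltW// a1_gt0.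
  - move=> i; rewrite /dual_mu_ext; case: ifP => si.
      rewrite le_eqVlt; apply/orP; left; apply/eqP; field.
      by rewrite !gt_eqF ?a1_gt0 ?dual_mu_gt0.
    (* Outside the dual states the right-hand side is 0, so the increment of F must vanish: F is 0
       at both i and i+1. *)
    rewrite /F /dirichlet_ext statesS; case: ifP => [/dual_statesW|_].
      by rewrite si.
    case: ifP => si'; last by rewrite subrr !mul0r expr0n mulr0.
    by have : dual_states N i by [case/andP: si']; rewrite si.
  - apply: ler_pM => //; try by apply: sumr_ge0.
      by rewrite -lee_fin -DfE DE partial_sum_le_nneseries.
    by rewrite -lee_fin VE dual_mu_sqE partial_sum_le_nneseries.
have d0 : (0 <= d)%R by rewrite -lee_fin -DfE D_ge0.
have V0 : (0 <= V)%R.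
  by rewrite -lee_fin VE dual_mu_sqE; apply: nneseries_ge0 => i _ _; rewrite lee_fin.
have V1 : (0 < V)%R.
  rewrite lt_neqAle V0 andbT; apply: contraTneq a1_gt0 => V'.
  by rewrite -leNgt (le_trans CS)// -V' mulr0.
apply: le_trans (dual_lambda1_le h0 V1 (ltW a1_gt0) _ hoo _) _.
- by rewrite VE.
- by rewrite Dh.
- by rewrite lee_fin ler_pdivrMr.
Qed.

(** * Part (1): the reverse inequality *)

Lemma finitely_supported_of_bound f n :
  (forall k, (n <= k)%N -> f k = 0%R) -> finitely_supported N f.
Proof.
move=> fn; apply: sub_finite_set (finite_II n) => k [_ fk] /=.
by rewrite ltnNge; apply/negP => /fn.
Qed.

Lemma mu_sq_finite_support f n :
  (forall k, (n <= k)%N -> f k = 0%R) ->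
  mu_sq N a b f = (\sum_(0 <= k < n) mu_ext k * f k ^+ 2)%:E.
Proof.
move=> fn; rewrite mu_sqE (nneseries_finite_support (n := n))//.
  by move=> i; rewrite mulr_ge0 ?sqr_ge0 ?mu_ext_ge0.
by move=> i ni; rewrite fn// expr0n mulr0.
Qed.

(** For finite N the partial sums are constant from N+1 on, hence equal to their limit 0. This is
    the Dirichlet condition at N+1. *)
Lemma series_eq0_of_not_states h k :
  (series (fun i => dual_mu_ext i * h i)%R @ \oo --> 0%R)%classic ->
  (0 < k)%N -> ~~ states N k ->
  series (fun i => dual_mu_ext i * h i)%R k = 0%R.
Proof.
move=> h0 k0 sk; apply: (cvg_unique _ _ h0); first exact: Rhausdorff.
apply: cvg_near_cst; exists k => // j /= kj.
apply/eqP; rewrite -subr_eq0 sub_series_geq//; apply/eqP.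
rewrite big_nat_cond big1// => i /andP[/andP[ki _] _].
rewrite /dual_mu_ext; case: ifP => [si|_]; last by rewrite mul0r.
by move: sk; rewrite /states k0 (le_enat_trans ki si).
Qed.

(** For f the soft threshold of the partial sums F, D(f) <= a_1, while <S f, h> >= c with c close to
    1. Cauchy-Schwarz gives a_1 c^2 <= mu(f^2) d, so the quotient of f is at most d / c^2 <= d +
    e. *)
Lemma lambda0_le_dual_D h : sum_inv_mua N a b < +oo ->
  dual_mean N a b h = 0 -> dual_mu_sq N a b h = 1 ->
  lambda0 N a b <= dual_D N a b h.
Proof.
move=> /dual_mu_summable soo mh h1.
have p20 i : (0 <= dual_mu_ext i * h i ^+ 2)%R.
  by rewrite mulr_ge0 ?dual_mu_ext_ge0 ?sqr_ge0.
set F := series (fun i => dual_mu_ext i * h i)%R.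
have FS k : (F k.+1 - F k = dual_mu_ext k * h k)%R.
  by rewrite /F seriesSr addrC addKr.
have F0 : (F @ \oo --> 0%R)%classic.
  have /cvg_ex[/= l Fl] : cvgn F.
    apply: weighted_mean_cvg => //; first exact: dual_mu_ext_ge0.
    by rewrite -dual_mu_sqE h1 ltry.
  by move: mh; rewrite dual_meanE (eseries_lim Fl) => -[<-].
have Fs k : (0 < k)%N -> ~~ states N k -> F k = 0%R.
  exact: series_eq0_of_not_states.
case DhE : (dual_D N a b h) => [d| |]; [|by rewrite leey|
  by have := dual_D_ge0 h; rewrite DhE].
have d0 : (0 <= d)%R by rewrite -lee_fin -DhE dual_D_ge0.
apply/lee_addgt0Pr => e e0; rewrite -EFinD.
(* A constant c < 1 with d / c^2 <= d + e. *)
pose c := ((d + e / 2) / (d + e))%R.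
have de : (0 < d + e)%R by rewrite ltr_wpDl.
have c0 : (0 < c)%R by rewrite divr_gt0//; lra.
have c1 : (c < 1)%R by rewrite ltr_pdivrMr//; lra.
have cd : (d <= (d + e) * c ^+ 2)%R.
  rewrite /c expr_div_n -[X in (_ * (_ / X))%R]/((d + e) * (d + e))%R.
  rewrite invfM mulrCA mulVKf ?gt_eqF// ler_pdivlMr//; nra.
(* The first n terms carry all of the unit norm except (1 - c) / 2; thresholding may lose another (1
   - c) / 2. *)
have [n hn] : exists n, ((1 + c) / 2 <
    \sum_(0 <= k < n) dual_mu_ext k * h k ^+ 2)%R.
  by apply: partial_sum_gt => //; rewrite -dual_mu_sqE h1 lte_fin; lra.
pose B := (\sum_(0 <= k < n) `|h k|)%R.
have B0 : (0 <= B)%R by apply: sumr_ge0.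
(* Chosen for the bound 2 eps B <= (1 - c) / 2 below; B + 1 avoids dividing by 0. *)
pose eps := ((1 - c) / (4 * (B + 1)))%R.
have eps0 : (0 < eps)%R by rewrite divr_gt0//; lra.
have epsB : (2 * eps * B <= (1 - c) / 2)%R.
  rewrite /eps mulrA mulrAC ler_pdivrMr; last lra.
  nra.
have /cvgrPdist_le/(_ eps eps0)[m _ Fm] := F0.
pose f k := soft_threshold eps (F k).
have fm k : (m <= k)%N -> f k = 0%R.
  by move=> /Fm /=; rewrite sub0r normrN; exact: soft_threshold0.
have fs k : ~~ states N k -> f k = 0%R.
  move=> sk; have -> : f k = soft_threshold eps 0%R.
    by rewrite /f; case: k sk => [_|k /Fs ->//]; rewrite /F /series/= big_geq.
  by rewrite soft_threshold0// normr0 ltW.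
have fE k : dirichlet_ext N f k = f k.
  by rewrite /dirichlet_ext; case: ifPn => // /fs.
have fB k : exists2 t, (0 <= t <= 1)%R &
    (f k.+1 - f k = t * (dual_mu_ext k * h k))%R.
  by rewrite -FS; exact/soft_thresholdB/ltW.
(* Each increment of f is t <= 1 times that of F, and S F = h has unit norm. *)
have Df : D N a b f <= (a 1)%:E.
  rewrite -[leRHS]mule1 -h1 dual_mu_sqE -nneseries_scale// DE.
  apply: lee_nneseries => [i _ _|i _]; rewrite lee_fin.
    by rewrite mulr_ge0 ?sqr_ge0 ?divr_ge0 ?dual_mu_ext_ge0// ltW// a1_gt0.
  have [t /andP[t0 t1]] := fB i; rewrite !fE => ->.
  have [->|p0] := eqVneq (dual_mu_ext i) 0%R; first by rewrite invr0; lra.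
  rewrite (_ : (_ / _ * _)%R = (a 1 * (t ^+ 2 * (dual_mu_ext i * h i ^+ 2)))%R).
    by rewrite ler_pM2l ?a1_gt0// ler_piMl// expr_le1.
  by field.
have t_ge0 k : (0 <= (f k.+1 - f k) * h k)%R.
  have [t /andP[t0 _] ->] := fB k.
  by rewrite -!mulrA -expr2 mulr_ge0// p20.
(* Beyond m, f vanishes, so the boundary term at M is 0; beyond n, the pairing only gains
   nonnegative terms. *)
pose M := maxn m n.
have cM : (c <= \sum_(0 <= k < M) (f k.+1 - f k) * h k)%R.
  rewrite (big_cat_nat (n := n))//= ?leq_maxr//.
  have : (0 <= \sum_(n <= k < M) (f k.+1 - f k) * h k)%R by apply: sumr_ge0.
  suff : (\sum_(0 <= k < n) dual_mu_ext k * h k ^+ 2 - 2 * eps * B <=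
          \sum_(0 <= k < n) (f k.+1 - f k) * h k)%R by lra.
  (* Thresholding moves F by at most eps at k and at k+1, so each term loses at most 2 eps |h_k|. *)
  rewrite /B mulr_sumr -sumrB; apply: ler_sum => k _.
  have := soft_threshold_dist (F k) (ltW eps0).
  have := soft_threshold_dist (F k.+1) (ltW eps0).
  rewrite -/(f k) -/(f k.+1) !ler_norml => /andP[? ?] /andP[? ?].
  rewrite expr2 mulrA -FS lerBlDr -lerBlDl -mulrBl.
  apply: le_trans (ler_norm _) _; rewrite normrM ler_wpM2r//.
  by rewrite ler_norml; apply/andP; split; lra.
have mufE := mu_sq_finite_support fm.
set v := (\sum_(0 <= k < m) _)%R in mufE.
have ad : (a 1 * c ^+ 2 <= v * d)%R.
  have fM : f M = 0%R by rewrite fm ?leq_maxl.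
  have f0 : f 0%N = 0%R by rewrite fs.
  have := @sqr_sum_le_mul _ (fun i => mu_ext i.+1 * f i.+1 ^+ 2)%R
    (fun i => (h i.+1 - h i) ^+ 2 / mu_ext i.+1)%R
    (fun k => f k.+1 * (h k.+1 - h k))%R M.
  rewrite -[X in (X ^+ 2)%R]opprK sqrrN.
  have := sum_by_parts f h M; rewrite fM f0 !mul0r subrr sub0r => <- CS.
  have {CS} : (c ^+ 2 <= (\sum_(0 <= i < M) mu_ext i.+1 * f i.+1 ^+ 2) *
      \sum_(0 <= i < M) (h i.+1 - h i) ^+ 2 / mu_ext i.+1)%R.
    apply: le_trans (CS _ _ _).
    - by rewrite ler_pXn2r// ?nnegrE ?sumr_ge0// ltW.
    - by move=> i; rewrite mulr_ge0 ?sqr_ge0 ?mu_ext_ge0.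
    - by move=> i; rewrite divr_ge0 ?sqr_ge0 ?mu_ext_ge0.
    (* A zero weight occurs only outside the state space, where f is 0. *)
    - move=> i; have [q0|q0] := eqVneq (mu_ext i.+1) 0%R.
        rewrite fs ?mul0r ?expr0n ?mulr0 ?mul0r//.
        by apply: contraTN (lexx (0 : R)%R) => si; move: q0;
          rewrite /mu_ext si => q0; move: (mu_gt0 si); rewrite q0 ltxx.
      by rewrite le_eqVlt; apply/orP; left; apply/eqP; field.
  move=> /(ler_wpM2l (ltW a1_gt0)) /le_trans; apply.
  rewrite mulrCA; apply: ler_pM.
  - by apply: sumr_ge0 => i _; rewrite mulr_ge0 ?sqr_ge0 ?mu_ext_ge0.
  - rewrite mulr_ge0 ?(ltW a1_gt0)// sumr_ge0// => i _.
    by rewrite divr_ge0 ?sqr_ge0 ?mu_ext_ge0.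
  - rewrite -lee_fin -mufE mu_sqE.
    have := @partial_sum_le_nneseries _ (fun k => mu_ext k * f k ^+ 2)%R M.+1.
    rewrite big_nat_recl//= mu_ext0 mul0r add0r; apply => i.
    by rewrite mulr_ge0 ?sqr_ge0 ?mu_ext_ge0.
  - rewrite -lee_fin -DhE dual_DE mulr_sumr.
    have := @partial_sum_le_nneseries _
      (fun k => a 1 / mu_ext k * (h k - h k.-1) ^+ 2)%R M.+1.
    rewrite big_nat_recl//= subrr expr0n mulr0 add0r.
    under eq_bigr do rewrite mulrAC -mulrA.
    apply => i.
    by rewrite mulr_ge0 ?sqr_ge0 ?divr_ge0 ?mu_ext_ge0// ltW// a1_gt0.
have v_ge0 : (0 <= v)%R.
  by apply: sumr_ge0 => i _; rewrite mulr_ge0 ?sqr_ge0 ?mu_ext_ge0.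
have v_gt0 : (0 < v)%R.
  rewrite lt_neqAle v_ge0 andbT; apply: contraTneq a1_gt0 => v0.
  rewrite -leNgt; move: ad; rewrite -v0 mul0r pmulr_lle0//.
  by rewrite exprn_gt0.
apply: le_trans (lambda0_le (finitely_supported_of_bound fm) v_gt0
  (ltW a1_gt0) _ _ Df) _.
- by rewrite mufE.
- by rewrite mufE ltry.
- rewrite lee_fin ler_pdivrMr//.
  have : (v * d <= v * ((d + e) * c ^+ 2))%R by rewrite ler_wpM2l.
  move=> /(le_trans ad); rewrite mulrA ler_pM2r ?exprn_gt0//.
  by rewrite mulrC.
Qed.

(** * Part (2): divergent weights *)

Lemma dual_mu_divergent : sum_inv_mua N a b = +oo ->
  \sum_(k <oo) (dual_mu_ext k)%:E = +oo.
Proof.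
move=> soo; apply/eqP; apply: contraTT isT; rewrite -ltey => poo.
suff : sum_inv_mua N a b < +oo by rewrite soo ltxx.
apply: (@le_lt_trans _ _ ((a 1)^-1%:E * \sum_(k <oo) (dual_mu_ext k)%:E));
  last by rewrite lte_mul_pinfty// lee_fin invr_ge0 ltW// a1_gt0.
rewrite -nneseries_scale; last exact: dual_mu_ext_ge0.
have ak k : (0 <= (a 1)^-1 * dual_mu_ext k)%R.
  by rewrite mulr_ge0 ?dual_mu_ext_ge0// invr_ge0 ltW// a1_gt0.
have sk k : (if states N k.+1 then dual_mu N a b k / a 1 else 0)%R =
    (if states N k.+1 then (a 1)^-1 * dual_mu_ext k else 0)%R.
  case: ifP => // sk; rewrite /dual_mu_ext dual_statesW//.
  by rewrite mulrC.
rewrite sum_inv_muaE; apply: lee_nneseries => k _; rewrite sk; case: ifP => // _.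
  by rewrite lee_fin.
by rewrite lee_fin.
Qed.

Lemma mu_ext_shift_divergent : mu_total N a b = +oo ->
  \sum_(k <oo) (mu_ext k.+1)%:E = +oo.
Proof.
have m0 k : 0 <= (mu_ext k)%:E by rewrite lee_fin mu_ext_ge0.
rewrite mu_totalE nneseries_recl// mu_ext0 add0e => <-.
rewrite -(@nneseries_addn _ (fun k => (mu_ext k)%:E) 1)//.
by apply: eq_eseriesr => k _; rewrite addn1.
Qed.

Lemma mu_total_infinite_states : mu_total N a b = +oo -> N = None.
Proof.
rewrite mu_totalE; case NE : N => [n|//].
rewrite (nneseries_finite_support (n := n.+1))// => [|i ni].
  exact: mu_ext_ge0.
by rewrite /mu_ext /states NE /= [(i <= n)%N]leqNgt ni andbF.
Qed.

Lemma dual_D0E h : dual_D0 N a b h =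
  \sum_(k <oo) (a 1 * ((h k.+1 - h k) ^+ 2 / mu_ext k.+1))%:E.
Proof.
rewrite /dual_D0 eseries_zero_ext; apply: eq_eseriesr => k _; congr (_%:E).
rewrite /mu_ext /dual_b; case: (boolP (states N k.+1)) => sk; last first.
  by rewrite invr0 !mulr0 mul0r; case: ifP.
rewrite (dual_statesW sk) -(mu_a_dual_mu sk); field.
by rewrite gt_eqF ?mu_gt0.
Qed.

Lemma dual_D0_ge0 h : 0 <= dual_D0 N a b h.
Proof.
rewrite dual_D0E; apply: nneseries_ge0 => k _ _; rewrite lee_fin.
by rewrite mulr_ge0 ?divr_ge0 ?sqr_ge0 ?mu_ext_ge0// ltW// a1_gt0.
Qed.

Lemma dual_D0Z (c : R) h :
  dual_D0 N a b (fun i => c * h i)%R = (c ^+ 2)%:E * dual_D0 N a b h.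
Proof.
rewrite !dual_D0E -nneseries_scale => [|i]; last first.
  by rewrite mulr_ge0 ?divr_ge0 ?sqr_ge0 ?mu_ext_ge0// ltW// a1_gt0.
by apply: eq_eseriesr => i _; congr (_%:E); ring.
Qed.

Lemma dual_finitely_supportedZ (c : R) h : dual_finitely_supported N h ->
  dual_finitely_supported N (fun i => c * h i)%R.
Proof.
by apply: sub_finite_set => k [sk ch]; split => // hk0; apply: ch; rewrite hk0 mulr0.
Qed.

(** A cutoff equal to 1 at 0, built on the weights mu_{k+1}, has energy at most e, while the state 0
    alone gives it squared norm at least 1. *)
Lemma dual_lambda0_eq0 : mu_total N a b = +oo -> dual_lambda0 N a b = 0.
Proof.
move=> /mu_ext_shift_divergent muoo; apply/eqP; rewrite eq_le; apply/andP; split;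
  last by apply/ereal_infP => _ [h _ <-]; exact: dual_D0_ge0.
apply/lee_addgt0Pr => e e0; rewrite add0e.
have ea0 : (0 < e / a 1)%R by rewrite divr_gt0 ?a1_gt0.
have [g [m [g1 gm gE]]] := exists_cutoff 0 (fun k => mu_ext_ge0 k.+1) ea0 muoo.
have gs : dual_finitely_supported N g.
  apply: sub_finite_set (finite_II m) => k [_ gk] /=.
  by rewrite ltnNge; apply/negP => /gm.
have g20 i : (0 <= dual_mu_ext i * g i ^+ 2)%R.
  by rewrite mulr_ge0 ?sqr_ge0 ?dual_mu_ext_ge0.
have gv : 1%:E <= dual_mu_sq N a b g.
  rewrite dual_mu_sqE; apply: le_trans (partial_sum_le_nneseries 1 g20).
  by rewrite big_nat1 g1// /dual_mu_ext dual_states0 dual_mu0 expr1n mulr1.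
have goo : dual_mu_sq N a b g < +oo.
  rewrite dual_mu_sqE (nneseries_finite_support (n := m)) ?ltry// => i mi.
  by rewrite gm// expr0n mulr0.
have gD : dual_D0 N a b g <= e%:E.
  rewrite dual_D0E nneseries_scale => [|i]; last first.
    by rewrite divr_ge0 ?sqr_ge0 ?mu_ext_ge0.
  rewrite (_ : e = a 1 * (e / a 1))%R; last by rewrite mulrC divfK// gt_eqF ?a1_gt0.
  by rewrite EFinM; apply: lee_wpmul2l => //; rewrite lee_fin ltW ?a1_gt0.
have [h [hs h1 hD]] := exists_normalized dual_mu_sqZ dual_D0Z
  dual_finitely_supportedZ gs ltr01 (ltW e0) gv goo gD.
by rewrite divr1 in hD; apply: le_trans hD; apply: ereal_inf_lbound; exists h.
Qed.

(** The jump from the Dirichlet value 0 to 1 costs a_1, so the energy itself is not small. It stays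
    below 2 a_1 while the mass, bounded below by the divergent mu, makes the quotient small. *)
Lemma lambda0_eq0 : sum_inv_mua N a b = +oo -> mu_total N a b = +oo ->
  lambda0 N a b = 0.
Proof.
move=> /dual_mu_divergent poo muoo; apply/eqP; rewrite eq_le; apply/andP; split;
  last by apply/ereal_infP => _ [h _ <-]; exact: D_ge0.
apply/lee_addgt0Pr => e e0; rewrite add0e.
have a0 := a1_gt0.
have NE := mu_total_infinite_states muoo.
have [n nv] : exists n, (2 * a 1 / e < \sum_(0 <= k < n) mu_ext k)%R.
  by apply: partial_sum_gt mu_ext_ge0 _; rewrite -mu_totalE muoo ltry.
(* The descent costs at most 1 before the factor a_1; the plateau up to n+1 contains the state 1
   whatever n is. *)
have [g [m [g1 gm gE]]] := exists_cutoff n.+1 dual_mu_ext_ge0 ltr01 poo.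
have p0 : dual_mu_ext 0 = 1%R by rewrite /dual_mu_ext dual_states0 dual_mu0.
have gS k : dirichlet_ext N g k.+1 = g k.+1 by rewrite /dirichlet_ext NE.
have t0 k : (0 <= (g k.+1 - g k) ^+ 2 / dual_mu_ext k)%R.
  by rewrite divr_ge0 ?sqr_ge0 ?dual_mu_ext_ge0.
have D2 : D N a b g <= (2 * a 1)%:E.
  rewrite mulr_natl mulr2n EFinD DE nneseries_recl//; last first.
    move=> k _; rewrite lee_fin mulr_ge0 ?sqr_ge0 ?divr_ge0 ?dual_mu_ext_ge0//.
    exact: ltW.
  apply: leeD.
    by rewrite p0 gS g1// subr0 expr1n divr1 mulr1.
  apply: (@le_trans _ _ ((a 1)%:E *
      \sum_(k <oo) ((g k.+1 - g k) ^+ 2 / dual_mu_ext k)%:E)); last first.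
    by rewrite -[leRHS]mule1; apply: lee_wpmul2l => //; rewrite lee_fin ltW.
  rewrite -nneseries_scale// [leRHS]nneseries_recl//; last first.
    by move=> k _; rewrite lee_fin mulr_ge0// ltW.
  (* The terms at 0 are set apart: g is 1 at 0 but its Dirichlet extension is 0 there. From 1 on the
     two agree. *)
  rewrite -[leLHS]add0e; apply: leeD; first by rewrite lee_fin mulr_ge0// ltW.
  rewrite eseries_cond [leRHS]eseries_cond; apply: lee_nneseries.
    move=> k _ _; rewrite lee_fin mulr_ge0 ?sqr_ge0 ?divr_ge0 ?dual_mu_ext_ge0//.
    exact: ltW.
  by case=> [//|k] _; rewrite !gS lee_fin mulrAC mulrA.
have v0 : (0 < 2 * a 1 / e)%R by rewrite divr_gt0// mulr_gt0.
apply: le_trans (lambda0_le (finitely_supported_of_bound gm) v0 _ _ _ D2) _.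
- by rewrite mulr_ge0// ltW.
- rewrite mu_sqE; apply: le_trans (partial_sum_le_nneseries n _); last first.
    by move=> i; rewrite mulr_ge0 ?sqr_ge0 ?mu_ext_ge0.
  rewrite lee_fin; apply: le_trans (ltW nv) _.
  rewrite !big_nat; apply: ler_sum => k /andP[_ kn].
  by rewrite g1 ?expr1n ?mulr1// ltnW// ltnS ltnW.
- by rewrite (mu_sq_finite_support gm) ltry.
- by rewrite lee_fin invf_div mulrCA divff ?mulr1// gt_eqF// mulr_gt0.
Qed.

Lemma lambda0_all_eq0 : sum_inv_mua N a b = +oo -> mu_total N a b = +oo ->
  lambda0_all N a b = 0.
Proof.
move=> soo muoo; apply/eqP; rewrite eq_le; apply/andP; split.
  rewrite -(lambda0_eq0 soo muoo); apply: ereal_inf_le_tmp.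
  by move=> _ [f [f1 _] <-]; exists f.
by apply/ereal_infP => _ [h _ <-]; exact: D_ge0.
Qed.

End birth_death_duality.

Theorem theorem7p1 (R : realType) (N : option nat) (a b : nat -> R)
    (hN : le_enat 1 N)
    (ha : forall i : nat, states N i -> (0 < a i)%R)
    (hb : forall i : nat, states N i -> (0 < b i)%R) :
  (sum_inv_mua N a b < +oo -> lambda0 N a b = dual_lambda1 N a b) /\
  (sum_inv_mua N a b = +oo -> mu_total N a b = +oo ->
     [/\ lambda0 N a b = dual_lambda0 N a b,
         lambda0_all N a b = dual_lambda0 N a b
       & dual_lambda0 N a b = 0]).
Proof.
split=> [soo|soo muoo]; last first.
  by rewrite lambda0_eq0// lambda0_all_eq0// dual_lambda0_eq0.
apply/eqP; rewrite eq_le; apply/andP; split; apply/ereal_infP.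
  by move=> _ [h [_ mh h1] <-]; exact: lambda0_le_dual_D.
by move=> _ [f [f1 ff] <-]; exact: dual_lambda1_le_D.
Qed.
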